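(* Let $a\ge0$ and $T>0$. Assume that $z\in G^3([0,T])$ with $$|z^{(j)}(t)|\le M\,\frac{(3j)!}{R^{3j}}\qquad\forall j\ge0,\ \forall t\in[0,T],$$ where $M>0$ and $R>1$, and let $$y(x,t)=\sum_{i\ge0}g_i(x)\,z^{(i)}(t),\qquad (x,t)\in[-1,0]\times[0,T],$$ where $(g_i)_{i\ge0}$ are the generating functions associated with $a$. Then $y\in G^{1,3}([-1,0]\times[0,T])$ and $y$ solves $$\begin{cases}\partial_t y+\partial_x^3 y+a\,\partial_x y=0, & x\in(-1,0),\ t\in(0,T),\\ y(0,t)=\partial_x y(0,t)=0, & t\in(0,T),\\ \partial_x^2y(0,t)=z(t), & t\in(0,T).\end{cases}$$
   Context: The generating functions $g_i:[-1,0]\to\mathbb R$, $i\ge0$, are defined inductively: $g_0$ is the solution of the Cauchy problem $g_0'''+a g_0'=0$ on $(-1,0)$, $g_0(0)=g_0'(0)=0$, $g_0''(0)=1$; and for $i\ge1$, $g_i$ is the solution of $g_i'''+a g_i'=-g_{i-1}$ on $(-1,0)$, $g_i(0)=g_i'(0)=g_i''(0)=0$. $\mathbb N=\{0,1,2,\dots\}$. For $s\ge 0$, $G^s([t_1,t_2])$ (functions Gevrey of order $s$) is the set of $u\in C^\infty([t_1,t_2])$ for which there are constants $C\ge 0$, $R>0$ with $|\partial_t^n u(t)|\le C\,(n!)^s/R^n$ for all $n\in\mathbb N$, $t\in[t_1,t_2]$. $G^{s_1,s_2}([x_1,x_2]\times[t_1,t_2])$ (functions Gevrey of order $s_1$ in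 $x$ and $s_2$ in $t$) is the set of $y\in C^\infty([x_1,x_2]\times[t_1,t_2])$ for which there are constants $C,R_1,R_2>0$ with $|\partial_x^{n_1}\partial_t^{n_2}y(x,t)|\le C\,(n_1!)^{s_1}(n_2!)^{s_2}/(R_1^{n_1}R_2^{n_2})$ for all $n_1,n_2\in\mathbb N$ and all $(x,t)$ in the rectangle. *)

(* Defs.v *)
From Stdlib Require Import Reals Factorial.
From Coquelicot Require Import Coquelicot.
Open Scope R_scope.

(* A function on a segment (or rectangle) is represented by a total function
   whose values elsewhere are irrelevant: every notion below only looks at
   values taken inside the set. *)
Definition segment (lo hi : R) (x : R) : Prop := lo <= x <= hi.

Definition rectangle (x1 x2 t1 t2 : R) (p : R * R) : Prop :=
  segment x1 x2 (fst p) /\ segment t1 t2 (snd p).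

(* u is C^oo on [t1,t2] with successive derivatives du 0 = u, du 1, du 2, ...
   D_in is differentiability relative to the segment, hence one-sided at the
   endpoints; for t1 < t2 it determines every du n on [t1,t2]. *)
Definition derivatives (t1 t2 : R) (u : R -> R) (du : nat -> R -> R) : Prop :=
  forall t, segment t1 t2 t ->
    du 0%nat t = u t /\
    forall n, D_in (du n) (du (S n)) (segment t1 t2) t.

(* y is C^oo on the closed rectangle, and dy n1 n2 is the partial derivative of
   order n1 in x and n2 in t; boundary derivatives are one-sided. *)
Definition partial_derivatives (x1 x2 t1 t2 : R) (y : R -> R -> R)
    (dy : nat -> nat -> R -> R -> R) : Prop :=
  (forall x t, rectangle x1 x2 t1 t2 (x, t) ->
    dy 0%nat 0%nat x t = y x t /\
    forall n1 n2,
      D_in (fun s => dy n1 n2 s t) (fun s => dy (S n1) n2 s t)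
        (segment x1 x2) x /\
      D_in (dy n1 n2 x) (dy n1 (S n2) x) (segment t1 t2) t) /\
  (forall n1 n2,
    continuous_on (rectangle x1 x2 t1 t2)
      (fun p : R * R => dy n1 n2 (fst p) (snd p))).

Definition gevrey (s t1 t2 : R) (u : R -> R) : Prop :=
  exists du : nat -> R -> R, derivatives t1 t2 u du /\
  exists C rho : R, 0 <= C /\ 0 < rho /\
    forall n t, segment t1 t2 t ->
      Rabs (du n t) <= C * Rpower (INR (fact n)) s / rho ^ n.

Definition gevrey2 (s1 s2 x1 x2 t1 t2 : R) (y : R -> R -> R) : Prop :=
  exists dy : nat -> nat -> R -> R -> R,
  partial_derivatives x1 x2 t1 t2 y dy /\
  exists C rho1 rho2 : R, 0 < C /\ 0 < rho1 /\ 0 < rho2 /\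
    forall n1 n2 x t, rectangle x1 x2 t1 t2 (x, t) ->
      Rabs (dy n1 n2 x t) <=
        C * (Rpower (INR (fact n1)) s1 * Rpower (INR (fact n2)) s2)
          / (rho1 ^ n1 * rho2 ^ n2).

(* g''' + a g' = f on (-1,0), with g(0) = 0, g'(0) = 0, g''(0) = c. *)
Definition cauchy_solution (a : R) (f : R -> R) (c : R) (g : R -> R) : Prop :=
  exists g1 g2 g3 : R -> R,
    (forall x, segment (-1) 0 x ->
      D_in g g1 (segment (-1) 0) x /\
      D_in g1 g2 (segment (-1) 0) x /\
      D_in g2 g3 (segment (-1) 0) x) /\
    (forall x, -1 < x < 0 -> g3 x + a * g1 x = f x) /\
    g 0 = 0 /\ g1 0 = 0 /\ g2 0 = c.

Definition generating_functions (a : R) (g : nat -> R -> R) : Prop :=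
  cauchy_solution a (fun _ => 0) 1 (g 0%nat) /\
  forall i, cauchy_solution a (fun x => - g i x) 0 (g (S i)).

(* Smooth solutions on [-1,0] x [0,T] of the linear KdV equation with the
   boundary data y = y_x = 0, y_xx = z at x = 0. *)
Definition solves_kdv (a T : R) (z : R -> R) (y : R -> R -> R) : Prop :=
  exists dy : nat -> nat -> R -> R -> R,
    partial_derivatives (-1) 0 0 T y dy /\
    (forall x t, -1 < x < 0 -> 0 < t < T ->
      dy 0%nat 1%nat x t + dy 3%nat 0%nat x t + a * dy 1%nat 0%nat x t = 0) /\
    (forall t, 0 < t < T ->
      y 0 t = 0 /\ dy 1%nat 0%nat 0 t = 0 /\ dy 2%nat 0%nat 0 t = z t).

(* Main.v *)
Require Import Defs.
From Stdlib Require Import Reals Factorial Arith Lra Lia.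
From Coquelicot Require Import Coquelicot.
Open Scope R_scope.

(** Let c(s,i) be the s-th derivative of g_i at 0; the differential equations say
    c(s+3,i) = - a c(s+1,i) - c(s,i-1), and c(s,i) = 0 for s < 3i+2. With r = 1/rho,
    induction on s gives
      sum_i |c(s,i)| (3i+p)! r^(3i) <= C (s+p)! r^s
    with C independent of p: the term c(s,i-1) merely propagates the bound at s,
    since 3i <= s+1, and the term in a costs a factor 1 + O(1/s^2), whose product
    over s converges. Summing over the Taylor expansion of g_i and using
    sum_j (j+p)!/j! r^j <= p!/(1-r)^(p+1) with p = n+3k, the series of the
    derivatives of order n in x and k in t is dominated, uniformly on the
    rectangle, by a constant times (n+3k)! (r/(1-r))^(n+3k), which is at most
    C n! (k!)^3 / (rho1^n rho2^k). So y may be differentiated termwise, and the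
    equation is a telescoping of the relations g_i''' + a g_i' = - g_(i-1). *)

(** * Factorial estimates *)

Lemma INR_fact_S (n : nat) : INR (fact (S n)) = (INR n + 1) * INR (fact n).
Proof. rewrite fact_simpl, mult_INR, S_INR. reflexivity. Qed.

Lemma INR_fact_ge1 (n : nat) : 1 <= INR (fact n).
Proof. apply (le_INR 1). pose proof (lt_O_fact n). lia. Qed.

(** Pascal's rule for the bound 2^(n+m) on a binomial coefficient: the new factor of the factorial
    splits as (n+1) + (m+1), and each part is absorbed by one induction hypothesis. *)
Lemma fact_add_le (n m : nat) :
  INR (fact (n + m)) <= 2 ^ (n + m) * (INR (fact n) * INR (fact m)).
Proof.
  remember (n + m)%nat as s eqn:Hs. revert n m Hs.
  induction s as [|s IH]; intros n m Hs.
  { replace n with 0%nat by lia. replace m with 0%nat by lia. simpl. lra. }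
  assert (H2 : 1 <= 2 ^ S s) by (apply pow_R1_Rle; lra).
  destruct n as [|n].
  { replace m with (S s) by lia. pose proof (INR_fact_ge1 (S s)).
    change (INR (fact 0)) with 1. nra. }
  destruct m as [|m].
  { replace (S n) with (S s) by lia. pose proof (INR_fact_ge1 (S s)).
    change (INR (fact 0)) with 1. nra. }
  assert (H1 := IH n (S m) ltac:(lia)). assert (H3 := IH (S n) m ltac:(lia)).
  rewrite (INR_fact_S s), !INR_fact_S in *.
  assert (E : INR s = INR n + INR m + 1)
    by (replace s with (n + S m)%nat by lia; rewrite plus_INR, S_INR; ring).
  pose proof (pos_INR n). pose proof (pos_INR m).
  rewrite E. simpl.
  apply Rmult_le_compat_l with (r := INR n + 1) in H1; [|lra].
  apply Rmult_le_compat_l with (r := INR m + 1) in H3; [|lra].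
  lra.
Qed.

(** One step in [k] multiplies the left side by (3k+3)(3k+2)(3k+1), at most 27 (k+1)^3. This is the
    source of the Gevrey order 3 in time. *)
Lemma fact_triple_le (k : nat) :
  INR (fact (3 * k)) <= 27 ^ k * INR (fact k) ^ 3.
Proof.
  induction k as [|k IH]; [simpl; lra|].
  replace (3 * S k)%nat with (S (S (S (3 * k)))) by lia.
  rewrite !INR_fact_S, !S_INR, mult_INR.
  pose proof (pos_INR k). pose proof (INR_fact_ge1 k).
  change (INR 3) with (1 + 1 + 1). rewrite Rpow_mult_distr.
  set (u := INR k) in *.
  apply Rle_trans with (27 * (u + 1) ^ 3 * (27 ^ k * INR (fact k) ^ 3)).
  2: simpl; lra.
  replace (((1 + 1 + 1) * u + 1 + 1 + 1) * (((1 + 1 + 1) * u + 1 + 1) *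
     (((1 + 1 + 1) * u + 1) * INR (fact (3 * k))))) with
    ((3 * u + 3) * (3 * u + 2) * (3 * u + 1) * INR (fact (3 * k))) by ring.
  apply Rmult_le_compat; try apply pos_INR; auto.
  - repeat apply Rmult_le_pos; lra.
  - nra.
Qed.

(** Partial sums of the negative binomial series, by induction on [p]: multiplication by 1 - r
    reduces the sum for p + 1 to p + 1 times the sum for p. *)
Lemma binomial_series_bound (r : R) (p J : nat) :
  0 <= r < 1 ->
  sum_f_R0 (fun j => INR (fact (j + p)) / INR (fact j) * r ^ j) J
    <= INR (fact p) / (1 - r) ^ (p + 1).
Proof.
  intros Hr. induction p as [|p IH].
  - rewrite (sum_eq _ (fun j => r ^ j)).
    + rewrite tech3 by lra. simpl (r ^ S J). change (INR (fact 0)) with 1.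
      assert (0 <= r * r ^ J)
        by (apply Rmult_le_pos; [lra | apply pow_le; lra]).
      replace ((1 - r) ^ (0 + 1)) with (1 - r) by (simpl; ring).
      apply Rmult_le_compat_r; [apply Rlt_le, Rinv_0_lt_compat|]; lra.
    + intros j _. rewrite Nat.add_0_r, Rdiv_diag by apply INR_fact_neq_0. ring.
  - assert (E : forall N,
      (1 - r) * sum_f_R0 (fun j => INR (fact (j + S p)) / INR (fact j) * r ^ j) N
      = (INR p + 1) * sum_f_R0 (fun j => INR (fact (j + p)) / INR (fact j) * r ^ j) N
        - INR (fact (N + S p)) / INR (fact N) * r ^ S N).
    { induction N as [|N IHN].
      - cbn [sum_f_R0]. rewrite !Nat.add_0_l, !INR_fact_S. simpl. field.
      - rewrite !tech5, !Rmult_plus_distr_l, IHN.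
        replace (S N + S p)%nat with (S (S (N + p))) by lia.
        replace (S N + p)%nat with (S (N + p)) by lia.
        replace (N + S p)%nat with (S (N + p)) by lia.
        rewrite !INR_fact_S, !S_INR, plus_INR. simpl.
        field. split; [apply INR_fact_neq_0|]. pose proof (pos_INR N). lra. }
    assert (H0 : 0 <= INR (fact (J + S p)) / INR (fact J) * r ^ S J).
    { apply Rmult_le_pos; [|apply pow_le; lra].
      apply Rdiv_le_0_compat; [apply pos_INR | apply INR_fact_lt_0]. }
    apply Rmult_le_reg_l with (1 - r); [lra|].
    rewrite E, INR_fact_S. pose proof (pos_INR p).
    apply Rmult_le_compat_l with (r := INR p + 1) in IH; [|lra].
    replace ((1 - r) * ((INR p + 1) * INR (fact p) / (1 - r) ^ (S p + 1))) with
      ((INR p + 1) * (INR (fact p) / (1 - r) ^ (p + 1))); [lra|].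
    simpl. field. split; [apply pow_nonzero|]; lra.
Qed.

(** * Taylor coefficients of the generating functions *)

(* [coef a s i] is the s-th derivative of g_i at 0. *)
Fixpoint coef (a : R) (s i : nat) : R :=
  match s with
  | S (S (S s'' as s1)) =>
      - a * coef a s1 i - match i with 0%nat => 0 | S i' => coef a s'' i' end
  | S (S 0) => match i with 0%nat => 1 | _ => 0 end
  | _ => 0
  end.

Lemma coef_SSS (a : R) (s i : nat) :
  coef a (S (S (S s))) i =
  - a * coef a (S s) i - match i with 0%nat => 0 | S i' => coef a s i' end.
Proof. reflexivity. Qed.

(** Each passage from g_(i-1) to g_i amounts to three integrations from 0, so the order of vanishing
    at 0 grows by three. *)
Lemma coef_eq0 (a : R) (s i : nat) : (s < 3 * i + 2)%nat -> coef a s i = 0.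
Proof.
  revert i. induction s as [s IH] using lt_wf_ind. intros i Hs.
  destruct s as [|[|[|s]]]; try reflexivity.
  - destruct i; [lia | reflexivity].
  - rewrite coef_SSS, (IH (S s)) by lia.
    destruct i as [|i]; [|rewrite (IH s) by lia]; ring.
Qed.

(** A crude bound resting on a (1+a) + 1 <= (1+a)^3; it serves to show that the Taylor series of the
    g_i converge everywhere. *)
Lemma coef_growth (a : R) (s i : nat) : 0 <= a -> Rabs (coef a s i) <= (1 + a) ^ s.
Proof.
  intros Ha. revert i. induction s as [s IH] using lt_wf_ind. intros i.
  assert (H1 : forall n, 0 < (1 + a) ^ n) by (intros; apply pow_lt; lra).
  destruct s as [|[|[|s]]].
  - simpl. rewrite Rabs_R0. lra.
  - simpl. rewrite Rabs_R0. lra.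
  - apply Rle_trans with 1; [|apply pow_R1_Rle; lra].
    destruct i; simpl; rewrite ?Rabs_R0, ?Rabs_R1; lra.
  - rewrite coef_SSS.
    apply Rle_trans with (a * (1 + a) ^ S s + (1 + a) ^ s).
    + eapply Rle_trans; [apply Rabs_triang|].
      rewrite Rabs_Ropp, Rabs_mult, Rabs_Ropp, (Rabs_pos_eq a) by lra.
      apply Rplus_le_compat.
      * apply Rmult_le_compat_l; [lra | apply IH; lia].
      * destruct i; [rewrite Rabs_R0; apply Rlt_le, H1 | apply IH; lia].
    + simpl. specialize (H1 s).
      assert (0 <= a * (1 + a) ^ s) by (apply Rmult_le_pos; lra).
      assert (0 <= a * a * (1 + a) ^ s) by (repeat apply Rmult_le_pos; lra).
      assert (0 <= a * a * a * (1 + a) ^ s) by (repeat apply Rmult_le_pos; lra).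
      nra.
Qed.

Lemma exp_le_compat (x y : R) : x <= y -> exp x <= exp y.
Proof. intros [H | ->]; [apply Rlt_le, exp_increasing, H | lra]. Qed.

(** With [p] = 3k the weight is, up to the factor M r^(3k), the bound assumed on the derivative of
    order i + k of z. *)
Definition weighted_coef (a r : R) (p s i : nat) : R :=
  Rabs (coef a s i) * (INR (fact (3 * i + p)) * r ^ (3 * i)).

Lemma weighted_coef_ge0 (a r : R) (p s i : nat) :
  0 < r -> 0 <= weighted_coef a r p s i.
Proof.
  intros Hr. apply Rmult_le_pos; [apply Rabs_pos|].
  apply Rmult_le_pos; [apply pos_INR | apply pow_le; lra].
Qed.

(** Moving to i + 1 multiplies the factorial by the three factors following 3i + p. A nonzero
    coefficient forces 3i + 2 <= s, so these are at most the factors leading from (s+p)! to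
    (s+p+3)!. *)
Lemma weighted_coef_shift (a r : R) (p s i : nat) :
  0 < r ->
  Rabs (coef a s i) * (INR (fact (3 * S i + p)) * r ^ (3 * S i)) <=
  (INR (s + p) + 3) * (INR (s + p) + 2) * (INR (s + p) + 1) * r ^ 3
    * weighted_coef a r p s i.
Proof.
  intros Hr. pose proof (weighted_coef_ge0 a r p s i Hr) as Hw.
  unfold weighted_coef in *.
  destruct (Nat.lt_ge_cases s (3 * i + 2)) as [Hs|Hs].
  { rewrite coef_eq0, Rabs_R0 by exact Hs. lra. }
  replace (3 * S i + p)%nat with (S (S (S (3 * i + p)))) by lia.
  replace (3 * S i)%nat with (3 * i + 3)%nat by lia.
  rewrite pow_add, !INR_fact_S, !S_INR.
  set (w := Rabs _ * _) in *.
  assert (Hle : INR (3 * i + p) + 2 <= INR (s + p)).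
  { change 2 with (INR 2). rewrite <- plus_INR. apply le_INR. lia. }
  pose proof (pos_INR (3 * i + p)). set (u := INR (3 * i + p)) in *.
  set (v := INR (s + p)) in *.
  replace (Rabs (coef a s i) * ((u + 1 + 1 + 1) * ((u + 1 + 1) *
    ((u + 1) * INR (fact (3 * i + p)))) * (r ^ (3 * i) * r ^ 3)))
    with ((u + 3) * (u + 2) * (u + 1) * r ^ 3 * w) by (unfold w; ring).
  apply Rmult_le_compat_r; [exact Hw|].
  apply Rmult_le_compat_r; [apply pow_le; lra|].
  repeat apply Rmult_le_compat; try lra.
  apply Rmult_le_pos; lra.
Qed.

Lemma sum_weighted_coef_rec (a r : R) (p s I : nat) :
  0 <= a -> 0 < r ->
  sum_f_R0 (weighted_coef a r p (S (S (S s)))) I <=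
  a * sum_f_R0 (weighted_coef a r p (S s)) I +
  (INR (s + p) + 3) * (INR (s + p) + 2) * (INR (s + p) + 1) * r ^ 3
    * sum_f_R0 (weighted_coef a r p s) I.
Proof.
  intros Ha Hr. set (q := _ * r ^ 3).
  assert (Hq : 0 <= q).
  { pose proof (pos_INR (s + p)).
    repeat apply Rmult_le_pos; try lra; apply pow_le; lra. }
  (* The shifted sum stops at I - 1; keeping the last term subtracted lets the induction on [I]
     close. *)
  apply Rle_trans with (a * sum_f_R0 (weighted_coef a r p (S s)) I +
    q * (sum_f_R0 (weighted_coef a r p s) I - weighted_coef a r p s I)).
  2: { pose proof (weighted_coef_ge0 a r p s I Hr). nra. }
  assert (Hstep : forall i, weighted_coef a r p (S (S (S s))) i <=
    a * weighted_coef a r p (S s) i + match i with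
    | 0%nat => 0 | S i' => q * weighted_coef a r p s i' end).
  { intros i. unfold weighted_coef at 1. rewrite coef_SSS.
    set (w := INR _ * _).
    assert (Hw : 0 <= w) by (apply Rmult_le_pos; [apply pos_INR | apply pow_le; lra]).
    eapply Rle_trans.
    { apply Rmult_le_compat_r; [exact Hw | apply Rabs_triang]. }
    rewrite Rabs_Ropp, Rabs_mult, Rabs_Ropp, (Rabs_pos_eq a) by lra.
    rewrite Rmult_plus_distr_r. apply Rplus_le_compat.
    - right. unfold weighted_coef, w. ring.
    - destruct i as [|i]; [rewrite Rabs_R0; lra|].
      apply weighted_coef_shift, Hr. }
  induction I as [|I IH].
  - simpl. specialize (Hstep 0%nat). lra.
  - specialize (Hstep (S I)). simpl sum_f_R0 in *. lra.
Qed.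

(* The recurrence costs a factor [1 + K / ((s + 2) (s + 3))] at each step; the
   infinite product converges, as [exp (- K / (s + 1))] makes explicit. *)
Lemma sum_weighted_coef_le (a r : R) (p I s : nat) :
  0 <= a -> 0 < r < 1 ->
  sum_f_R0 (weighted_coef a r p s) I <=
  exp (a / r ^ 2) / r ^ 2 * exp (- (a / r ^ 2 / (INR s + 1)))
    * (INR (fact (s + p)) * r ^ s).
Proof.
  intros Ha [Hr Hr1]. set (K := a / r ^ 2).
  assert (Hr2 : 0 < r ^ 2) by (apply pow_lt; lra).
  assert (HK : 0 <= K) by (apply Rdiv_le_0_compat; lra).
  set (C0 := exp K / r ^ 2).
  assert (HC0 : 0 < C0) by (apply Rdiv_lt_0_compat; [apply exp_pos | lra]).
  assert (Hz : forall s', (s' < 2)%nat -> sum_f_R0 (weighted_coef a r p s') I <=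
     C0 * exp (- (K / (INR s' + 1))) * (INR (fact (s' + p)) * r ^ s')).
  { intros s' Hs'. rewrite sum_eq_R0.
    - pose proof (exp_pos (- (K / (INR s' + 1)))).
      apply Rmult_le_pos; [|apply Rmult_le_pos; [apply pos_INR | apply pow_le; lra]].
      apply Rmult_le_pos; lra.
    - intros i _. unfold weighted_coef. rewrite coef_eq0, Rabs_R0 by lia. ring. }
  induction s as [s IH] using lt_wf_ind.
  destruct s as [|[|[|s]]]; [apply Hz; lia | apply Hz; lia | |].
  (* At order 2 only g_0 contributes. The constant [C0] is chosen for this case: 1 / r^2 cancels
     r^2, and exp K outweighs exp (- K / 3). *)
  - assert (Hs : sum_f_R0 (weighted_coef a r p 2) I = INR (fact p)).
    { clear Hz IH. induction I as [|I IHI].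
      - simpl. unfold weighted_coef. simpl. rewrite Rabs_R1. ring.
      - rewrite tech5, IHI. unfold weighted_coef. simpl coef. rewrite Rabs_R0. ring. }
    rewrite Hs.
    apply Rle_trans with (1 * (INR (fact (2 + p)))).
    + rewrite Rmult_1_l. apply le_INR, fact_le. lia.
    + replace (C0 * exp (- (K / (INR 2 + 1))) * (INR (fact (2 + p)) * r ^ 2)) with
        (exp K * exp (- (K / (INR 2 + 1))) * INR (fact (2 + p)))
        by (unfold C0; field; lra).
      apply Rmult_le_compat_r; [apply pos_INR|].
      rewrite <- exp_plus. apply Rle_trans with (exp 0); [rewrite exp_0; lra|].
      apply exp_le_compat. simpl INR.
      replace (K + - (K / (1 + 1 + 1))) with (2 / 3 * K) by field. lra.
  - eapply Rle_trans; [apply sum_weighted_coef_rec; lra|].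
    assert (I1 := IH (S s) ltac:(lia)). assert (I0 := IH s ltac:(lia)).
    replace (S (S (S s)) + p)%nat with (S (S (S (s + p)))) by lia.
    replace (S s + p)%nat with (S (s + p)) in I1 by lia.
    rewrite !INR_fact_S, !S_INR in *.
    set (v := INR (s + p)) in *. set (u := INR s) in *.
    assert (Hu : 0 <= u) by apply pos_INR.
    assert (Huv : u <= v) by (apply le_INR; lia).
    set (W := INR (fact (s + p)) * r ^ s) in *.
    assert (HW : 0 <= W) by (apply Rmult_le_pos; [apply pos_INR | apply pow_le; lra]).
    set (e2 := exp (- (K / (u + 1 + 1)))) in *.
    assert (He2 : 0 < e2) by apply exp_pos.
    set (Q := (v + 3) * (v + 2) * (v + 1) * r ^ 3 * W).
    assert (HQ : 0 <= Q).
    { unfold Q. apply Rmult_le_pos; [|exact HW].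
      repeat apply Rmult_le_pos; try lra; apply pow_le; lra. }
    (* Between orders s + 1 and s + 3 the bound gains r^2 (v+2)(v+3), so the term in [a] is only a
       fraction K / ((v+2)(v+3)) of the main one. *)
    assert (J1 : a * sum_f_R0 (weighted_coef a r p (S s)) I <=
       C0 * e2 * Q * (K / ((v + 2) * (v + 3)))).
    { eapply Rle_trans; [apply Rmult_le_compat_l; [lra | exact I1]|].
      right. unfold Q, W, K. simpl. field. repeat split; lra. }
    assert (J0 : (v + 3) * (v + 2) * (v + 1) * r ^ 3
       * sum_f_R0 (weighted_coef a r p s) I <= C0 * e2 * Q).
    { apply Rle_trans with ((v + 3) * (v + 2) * (v + 1) * r ^ 3 *
        (C0 * exp (- (K / (u + 1))) * W)).
      - apply Rmult_le_compat_l; [|exact I0].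
        repeat apply Rmult_le_pos; try lra; apply pow_le; lra.
      - replace (_ * _) with (C0 * exp (- (K / (u + 1))) * Q)
          by (unfold Q; ring).
        apply Rmult_le_compat_r; [exact HQ|].
        apply Rmult_le_compat_l; [lra|].
        apply exp_le_compat, Ropp_le_contravar.
        apply Rmult_le_compat_l; [exact HK|].
        apply Rinv_le_contravar; lra. }
    (* By 1 + x <= exp x and K / ((u+2)(u+3)) = K / (u+2) - K / (u+3), the exponent telescopes to -
       K / (u+3), which is at most the required - K / (u+4). *)
    assert (J2 : e2 * (K / ((v + 2) * (v + 3)) + 1) <= exp (- (K / (u + 1 + 1 + 1 + 1)))).
    { apply Rle_trans with (e2 * exp (K / ((u + 2) * (u + 3)))).
      - apply Rmult_le_compat_l; [lra|].
        eapply Rle_trans; [|apply exp_ineq1_le].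
        rewrite Rplus_comm. apply Rplus_le_compat_l, Rmult_le_compat_l; [exact HK|].
        apply Rinv_le_contravar; [nra|]. apply Rmult_le_compat; lra.
      - unfold e2. rewrite <- exp_plus. apply exp_le_compat.
        replace (- (K / (u + 1 + 1)) + K / ((u + 2) * (u + 3))) with (- (K / (u + 3)))
          by (field; lra).
        apply Ropp_le_contravar, Rmult_le_compat_l; [exact HK|].
        apply Rinv_le_contravar; lra. }
    apply Rle_trans with (C0 * Q * (e2 * (K / ((v + 2) * (v + 3)) + 1))); [lra|].
    eapply Rle_trans.
    { apply Rmult_le_compat_l; [|exact J2]. apply Rmult_le_pos; lra. }
    right. unfold Q, W. simpl. ring.
Qed.

(** * One-sided calculus on a segment *)

(** Composition with this projection extends a function known on the segment to the whole line, so
    that the two-sided mean value theorem applies. *)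
Definition clamp (lo hi x : R) : R := Rmax lo (Rmin hi x).

Lemma clamp_segment (lo hi x : R) : lo <= hi -> segment lo hi (clamp lo hi x).
Proof.
  intros H. unfold segment, clamp, Rmax, Rmin.
  repeat destruct Rle_dec; lra.
Qed.

Lemma clamp_id (lo hi x : R) : segment lo hi x -> clamp lo hi x = x.
Proof.
  unfold segment, clamp, Rmax, Rmin. intros H.
  repeat destruct Rle_dec; lra.
Qed.

Lemma clamp_dist (lo hi x y : R) :
  segment lo hi x -> Rabs (clamp lo hi y - x) <= Rabs (y - x).
Proof.
  unfold segment, clamp, Rmax, Rmin. intros H.
  repeat destruct Rle_dec; unfold Rabs; repeat destruct Rcase_abs; lra.
Qed.

(** Endpoints are included, since the projection never increases the distance to a point of the
    segment. *)
Lemma clamp_continuity_pt (lo hi : R) (f h : R -> R) (x : R) :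
  lo <= hi -> segment lo hi x -> D_in f h (segment lo hi) x ->
  continuity_pt (fun s => f (clamp lo hi s)) x.
Proof.
  intros Hle Hx HD. apply cont_deriv in HD.
  intros eps Heps. destruct (HD eps Heps) as [alp [Halp Hlim]].
  exists alp. split; [exact Halp|]. intros s [_ Hs]. simpl in *. unfold Rdist in *.
  rewrite (clamp_id lo hi x Hx).
  pose proof (clamp_dist lo hi x s Hx).
  (* The limit in [HD] excludes the point [x] itself, onto which the projection may collapse [s]. *)
  destruct (Req_dec (clamp lo hi s) x) as [->|Hne].
  - rewrite Rminus_diag, Rabs_R0. exact Heps.
  - apply Hlim. split; [|lra]. split; [apply clamp_segment, Hle | apply not_eq_sym, Hne].
Qed.

Lemma clamp_derivable_pt_lim (lo hi : R) (f h : R -> R) (x : R) :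
  lo < x < hi -> D_in f h (segment lo hi) x ->
  derivable_pt_lim (fun s => f (clamp lo hi s)) x (h x).
Proof.
  intros Hx HD eps Heps. destruct (HD eps Heps) as [alp [Halp Hlim]].
  assert (Hd : 0 < Rmin alp (Rmin (x - lo) (hi - x)))
    by (repeat apply Rmin_glb_lt; lra).
  exists (mkposreal _ Hd). intros d Hd0 Hdd. simpl in Hdd.
  assert (H1 : Rabs d < alp) by (eapply Rlt_le_trans; [exact Hdd | apply Rmin_l]).
  assert (H2 : Rabs d < Rmin (x - lo) (hi - x))
    by (eapply Rlt_le_trans; [exact Hdd | apply Rmin_r]).
  assert (H3 : Rabs d < x - lo) by (eapply Rlt_le_trans; [exact H2 | apply Rmin_l]).
  assert (H4 : Rabs d < hi - x) by (eapply Rlt_le_trans; [exact H2 | apply Rmin_r]).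
  apply Rabs_def2 in H3. apply Rabs_def2 in H4.
  rewrite !clamp_id by (unfold segment; lra).
  specialize (Hlim (x + d)). simpl in Hlim. unfold Rdist in Hlim.
  replace (x + d - x) with d in Hlim by ring.
  apply Hlim. repeat split; unfold segment; try lra.
Qed.

(* Only the interior bound on the derivative matters: the differential equations
   of the generating functions say nothing at the endpoints. *)
Lemma mean_value_le (lo hi : R) (f h : R -> R) (B : R) :
  lo <= hi ->
  (forall x, segment lo hi x -> D_in f h (segment lo hi) x) ->
  (forall x, lo < x < hi -> Rabs (h x) <= B) ->
  Rabs (f hi - f lo) <= B * (hi - lo).
Proof.
  intros [Hlt | <-] HD HB.
  2: { rewrite !Rminus_diag, Rabs_R0. lra. }
  set (F := fun s => f (clamp lo hi s)).
  assert (HF : forall c, lo < c < hi -> derivable_pt_lim F c (h c)).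
  { intros c Hc. apply clamp_derivable_pt_lim; [exact Hc|].
    apply HD. unfold segment. lra. }
  destruct (MVT F id lo hi (fun c Hc => exist _ (h c) (HF c Hc))
    (fun c _ => derivable_pt_id c) Hlt) as [c [Hc E]].
  - intros c Hc. apply clamp_continuity_pt with h; [lra | exact Hc | apply HD, Hc].
  - intros c _. apply derivable_continuous_pt, derivable_pt_id.
  - rewrite derive_pt_id in E. simpl in E. unfold id, F in E.
    rewrite !clamp_id in E by (unfold segment; lra).
    replace (f hi - f lo) with ((hi - lo) * h c) by lra.
    rewrite Rabs_mult, Rabs_pos_eq, Rmult_comm by lra.
    apply Rmult_le_compat_r; [lra | apply HB, Hc].
Qed.

Lemma segment_lipschitz (lo hi : R) (f h : R -> R) (B x y : R) :
  (forall x, segment lo hi x -> D_in f h (segment lo hi) x) ->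
  (forall x, lo < x < hi -> Rabs (h x) <= B) ->
  segment lo hi x -> segment lo hi y ->
  Rabs (f y - f x) <= B * Rabs (y - x).
Proof.
  intros HD HB.
  assert (H : forall x y, x <= y -> segment lo hi x -> segment lo hi y ->
    Rabs (f y - f x) <= B * (y - x)).
  { clear x y. intros x y Hxy Hx Hy. unfold segment in *.
    apply mean_value_le with h; [exact Hxy| |].
    - intros s Hs. unfold segment in Hs.
      apply D_in_imp with (segment lo hi); [unfold segment; intros; lra|].
      apply HD. unfold segment. lra.
    - intros s Hs. apply HB. lra. }
  intros Hx Hy. destruct (Rle_dec x y).
  - rewrite (Rabs_pos_eq (y - x)) by lra. auto.
  - rewrite (Rabs_minus_sym (f y)), (Rabs_left (y - x)) by lra.
    replace (- (y - x)) with (x - y) by ring. apply H; auto; lra.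
Qed.

Lemma D_in_of_quadratic (D : R -> Prop) (f h : R -> R) (B x : R) :
  (forall y, D y -> Rabs (f y - f x - h x * (y - x)) <= B * (y - x) ^ 2) ->
  D_in f h D x.
Proof.
  intros HB eps Heps.
  (* No sign is assumed on [B]; this denominator keeps the radius positive. *)
  exists (eps / (Rabs B + 1)).
  pose proof (Rabs_pos B). pose proof (Rle_abs B).
  split; [apply Rdiv_lt_0_compat; lra|].
  intros y [[HDy Hne] Hy]. simpl in Hy |- *. unfold Rdist in *.
  specialize (HB y HDy).
  assert (Hyx : 0 < Rabs (y - x)) by (apply Rabs_pos_lt; lra).
  replace ((f y - f x) / (y - x) - h x) with
    ((f y - f x - h x * (y - x)) / (y - x)) by (field; lra).
  rewrite Rabs_div by lra.
  rewrite <- (pow2_abs (y - x)) in HB.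
  apply Rle_lt_trans with ((Rabs B + 1) * Rabs (y - x)).
  - apply Rmult_le_reg_r with (Rabs (y - x)); [exact Hyx|].
    unfold Rdiv. rewrite Rmult_assoc, Rinv_l by lra. nra.
  - apply Rmult_lt_reg_r with (/ (Rabs B + 1)); [apply Rinv_0_lt_compat; lra|].
    rewrite Rmult_comm, <- Rmult_assoc, Rinv_l, Rmult_1_l by lra. exact Hy.
Qed.

(** The mean value inequality is used twice: it bounds h s - h x by B |s - x|, and this difference
    is the derivative of f s - h x * s. The cruder constant B in place of B / 2 suffices. *)
Lemma taylor2_le (lo hi : R) (f h l : R -> R) (B x y : R) :
  (forall x, segment lo hi x -> D_in f h (segment lo hi) x) ->
  (forall x, segment lo hi x -> D_in h l (segment lo hi) x) ->
  (forall x, segment lo hi x -> Rabs (l x) <= B) ->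
  segment lo hi x -> segment lo hi y ->
  Rabs (f y - f x - h x * (y - x)) <= B * (y - x) ^ 2.
Proof.
  intros Hf Hh Hl Hx Hy.
  assert (HB : 0 <= B) by (eapply Rle_trans; [apply Rabs_pos | apply Hl, Hx]).
  (* Restricting to the segment between [x] and [y] makes |s - x| at most |y - x|. *)
  set (u := Rmin x y). set (v := Rmax x y).
  assert (Huv : lo <= u /\ v <= hi /\ u <= x <= v /\ u <= y <= v /\
     v - u = Rabs (y - x)).
  { unfold u, v, segment, Rmin, Rmax, Rabs in *.
    destruct Rle_dec; destruct Rcase_abs; lra. }
  clearbody u v. destruct Huv as (Hu & Hv & Hxuv & Huvy & E).
  replace (f y - f x - h x * (y - x)) with ((f y - h x * y) - (f x - h x * x)) by ring.
  rewrite <- (pow2_abs (y - x)).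
  replace (B * Rabs (y - x) ^ 2) with (B * Rabs (y - x) * Rabs (y - x)) by ring.
  apply (segment_lipschitz u v (fun s => f s - h x * s) (fun s => h s - h x * 1));
    try (unfold segment; lra).
  - intros s Hs. unfold segment in Hs.
    apply D_in_imp with (segment lo hi); [unfold segment; intros; lra|].
    apply (Dminus _ h (fun _ => h x * 1) f (fun s => h x * s)).
    + apply Hf. unfold segment. lra.
    + apply (Dmult_const _ (fun s => s) (fun _ => 1)), Dx.
  - intros s Hs. rewrite Rmult_1_r.
    eapply Rle_trans.
    { apply (segment_lipschitz lo hi h l B); auto.
      - intros; apply Hl; unfold segment; lra.
      - unfold segment; lra. }
    apply Rmult_le_compat_l; [exact HB|]. rewrite <- E.
    unfold Rabs; destruct Rcase_abs; lra.
Qed.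

(** * Dominated series and termwise differentiation *)

Lemma ex_series_abs_le (u b : nat -> R) :
  (forall i, Rabs (u i) <= b i) -> ex_series b -> ex_series u.
Proof. intros Hu Hb. apply (ex_series_le u b); auto. Qed.

Lemma Series_abs_le (u b : nat -> R) :
  (forall i, Rabs (u i) <= b i) -> ex_series b -> Rabs (Series u) <= Series b.
Proof.
  intros Hu Hb. eapply Rle_trans.
  - apply Series_Rabs. apply ex_series_abs_le with b; auto.
    intros i. rewrite Rabs_Rabsolu. apply Hu.
  - apply Series_le; auto. intros i. split; [apply Rabs_pos | apply Hu].
Qed.

(* Summable second derivatives let Taylor's formula be summed directly, which
   avoids splitting off a tail of the series. *)
Lemma D_in_Series (lo hi : R) (f h l : nat -> R -> R) (bf bh bl : nat -> R) (x : R) :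
  (forall i x, segment lo hi x -> D_in (f i) (h i) (segment lo hi) x) ->
  (forall i x, segment lo hi x -> D_in (h i) (l i) (segment lo hi) x) ->
  (forall i x, segment lo hi x -> Rabs (f i x) <= bf i) ->
  (forall i x, segment lo hi x -> Rabs (h i x) <= bh i) ->
  (forall i x, segment lo hi x -> Rabs (l i x) <= bl i) ->
  ex_series bf -> ex_series bh -> ex_series bl ->
  segment lo hi x ->
  D_in (fun s => Series (fun i => f i s)) (fun s => Series (fun i => h i s))
    (segment lo hi) x.
Proof.
  intros Hf Hh Bf Bh Bl Sf Sh Sl Hx.
  apply D_in_of_quadratic with (Series bl). intros y Hy.
  assert (Ef : forall s, segment lo hi s -> ex_series (fun i => f i s))
    by (intros; apply ex_series_abs_le with bf; auto).
  assert (Eh : ex_series (fun i => h i x * (y - x)))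
    by (apply ex_series_scal_r, ex_series_abs_le with bh; auto).
  rewrite <- Series_minus, <- Series_scal_r, <- Series_minus, <- Series_scal_r; auto.
  - apply Series_abs_le; [|apply ex_series_scal_r, Sl].
    intros i. apply taylor2_le with lo hi (l i); auto.
  - apply (ex_series_minus (fun i => f i y) (fun i => f i x)); auto.
Qed.

Lemma ex_series_bounded (u : nat -> R) (B : R) :
  (forall n, 0 <= u n) -> (forall n, sum_f_R0 u n <= B) ->
  ex_series u /\ Series u <= B.
Proof.
  intros Hu HB.
  assert (Hex : ex_series u).
  { destruct (ex_finite_lim_seq_incr (sum_n u) B) as [l Hl].
    - intros n. rewrite sum_Sn. unfold plus; simpl. specialize (Hu (S n)). lra.
    - intros n. rewrite sum_n_Reals. apply HB.
    - exists l. exact Hl. }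
  split; [exact Hex|].
  apply (is_lim_seq_le (sum_n u) (fun _ => B) (Series u) B).
  - intros n. rewrite sum_n_Reals. apply HB.
  - apply Series_correct, Hex.
  - apply is_lim_seq_const.
Qed.

(** Exchange of a sum over i with a series over j. One index stays finite, which is enough because
    the sum over i is bounded through its partial sums. *)
Lemma is_series_sum (u : nat -> nat -> R) (I : nat) :
  (forall i, ex_series (u i)) ->
  is_series (fun j => sum_f_R0 (fun i => u i j) I) (sum_f_R0 (fun i => Series (u i)) I).
Proof.
  intros Hu. induction I as [|I IH]; simpl.
  - apply Series_correct, Hu.
  - apply (is_series_plus _ (u (S I)) _ (Series (u (S I)))); [exact IH|].
    apply Series_correct, Hu.
Qed.

(** * Generating functions *)

Definition gen_coef (a : R) (i n j : nat) : R := coef a (n + j) i / INR (fact j).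

(* The n-th derivative of g_i. *)
Definition gen (a : R) (i n : nat) (x : R) : R := PSeries (gen_coef a i n) x.

(** The l^1 norm of the Taylor coefficients, which dominates the derivative on all of [-1,1]. *)
Definition gen_bound (a : R) (i n : nat) : R := Series (fun j => Rabs (gen_coef a i n j)).

(** The terms at radius r are at most (1+a)^n times those of the exponential series at (1+a) r,
    hence bounded. Boundedness only gives a radius at least r, so r is taken strictly above |x|. *)
Lemma gen_coef_radius (a x : R) (i n : nat) :
  0 <= a -> Rbar_lt (Rabs x) (CV_radius (gen_coef a i n)).
Proof.
  intros Ha. set (r := Rabs x + 1).
  assert (Hr : 0 < r) by (pose proof (Rabs_pos x); unfold r; lra).
  apply Rbar_lt_le_trans with (Finite r); [unfold r; simpl; lra|].
  apply (proj1 (CV_radius_bounded (gen_coef a i n))).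
  exists ((1 + a) ^ n * exp ((1 + a) * r)). intros j.
  unfold gen_coef. pose proof (INR_fact_lt_0 j) as Hf.
  rewrite Rabs_mult, Rabs_div, (Rabs_pos_eq (INR _)), (Rabs_pos_eq (r ^ j))
    by (try apply pow_le; lra).
  apply Rle_trans with ((1 + a) ^ n * (((1 + a) * r) ^ j / INR (fact j))).
  - rewrite Rpow_mult_distr.
    replace ((1 + a) ^ n * ((1 + a) ^ j * r ^ j / INR (fact j))) with
      ((1 + a) ^ (n + j) / INR (fact j) * r ^ j) by (rewrite pow_add; field; lra).
    apply Rmult_le_compat_r; [apply pow_le; lra|].
    apply Rmult_le_compat_r; [apply Rlt_le, Rinv_0_lt_compat, Hf|].
    apply coef_growth, Ha.
  - apply Rmult_le_compat_l; [apply pow_le; lra|].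
    assert (H0 : 0 <= (1 + a) * r) by (apply Rmult_le_pos; lra).
    assert (Ht : forall k, 0 <= ((1 + a) * r) ^ k / INR (fact k)).
    { intros k. apply Rdiv_le_0_compat; [apply pow_le, H0 | apply INR_fact_lt_0]. }
    eapply Rle_trans; [|apply (exp_ge_taylor _ j), H0].
    destruct j as [|j]; [simpl; lra|]. rewrite tech5.
    pose proof (cond_pos_sum _ j Ht). lra.
Qed.

Lemma gen_derive (a : R) (i n : nat) (x : R) (D : R -> Prop) :
  0 <= a -> D_in (gen a i n) (gen a i (S n)) D x.
Proof.
  intros Ha. apply D_in_imp with no_cond; [intros; exact I|].
  apply derivable_pt_lim_D_in, is_derive_Reals.
  replace (gen a i (S n) x) with (PSeries (PS_derive (gen_coef a i n)) x).
  - apply is_derive_PSeries, gen_coef_radius, Ha.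
  - apply PSeries_ext. intros j. unfold PS_derive, gen_coef.
    rewrite INR_fact_S, S_INR, Nat.add_succ_r. simpl Nat.add.
    pose proof (INR_fact_lt_0 j). pose proof (pos_INR j). field. lra.
Qed.

Lemma gen_at_0 (a : R) (i n : nat) : gen a i n 0 = coef a n i.
Proof.
  unfold gen. rewrite PSeries_0. unfold gen_coef. rewrite Nat.add_0_r. simpl. field.
Qed.

Lemma ex_series_gen (a x : R) (i n : nat) :
  0 <= a -> ex_series (fun j => gen_coef a i n j * x ^ j).
Proof.
  intros Ha. apply ex_series_Rabs, CV_disk_inside, gen_coef_radius, Ha.
Qed.

Lemma ex_series_gen_bound (a : R) (i n : nat) :
  0 <= a -> ex_series (fun j => Rabs (gen_coef a i n j)).
Proof.
  intros Ha.
  apply (ex_series_ext (fun j => Rabs (gen_coef a i n j * 1 ^ j))).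
  - intros j. rewrite pow1, Rmult_1_r. reflexivity.
  - apply CV_disk_inside, gen_coef_radius, Ha.
Qed.

Lemma gen_le_bound (a : R) (i n : nat) (x : R) :
  0 <= a -> Rabs x <= 1 -> Rabs (gen a i n x) <= gen_bound a i n.
Proof.
  intros Ha Hx. apply Series_abs_le; [|apply ex_series_gen_bound, Ha].
  intros j. rewrite Rabs_mult, <- RPow_abs, <- (Rmult_1_r (Rabs (gen_coef _ _ _ _))) at 1.
  rewrite Rmult_assoc, Rmult_1_l.
  rewrite <- (Rmult_1_r (Rabs (gen_coef a i n j))) at 2.
  apply Rmult_le_compat_l; [apply Rabs_pos|].
  rewrite <- (pow1 j). apply pow_incr. split; [apply Rabs_pos | exact Hx].
Qed.

Lemma gen_ode_0 (a : R) (n : nat) (x : R) :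
  0 <= a -> gen a 0 (S (S (S n))) x = - a * gen a 0 (S n) x.
Proof.
  intros Ha. unfold gen, PSeries. rewrite <- Series_scal_l.
  apply Series_ext. intros j. unfold gen_coef. simpl Nat.add. rewrite coef_SSS.
  pose proof (INR_fact_lt_0 j). field. lra.
Qed.

Lemma gen_ode_S (a : R) (i n : nat) (x : R) :
  0 <= a ->
  gen a (S i) (S (S (S n))) x = - a * gen a (S i) (S n) x - gen a i n x.
Proof.
  intros Ha. unfold gen, PSeries. rewrite <- Series_scal_l, <- Series_minus.
  - apply Series_ext. intros j. unfold gen_coef. simpl Nat.add. rewrite coef_SSS.
    pose proof (INR_fact_lt_0 j). field. lra.
  - apply (ex_series_scal_l (K := R_AbsRing) (- a)
      (fun j => gen_coef a (S i) (S n) j * x ^ j)), ex_series_gen, Ha.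
  - apply ex_series_gen, Ha.
Qed.

(* Energy argument: [d2 ^ 2 + a d1 ^ 2] is constant for a difference [d] of
   solutions, and [0 <= a] makes it definite enough. *)
Lemma cauchy_solution_unique (a : R) (f : R -> R) (c : R) (u v : R -> R) (x : R) :
  0 <= a -> cauchy_solution a f c u -> cauchy_solution a f c v ->
  segment (-1) 0 x -> u x = v x.
Proof.
  intros Ha (u1 & u2 & u3 & Du & Eu & U0 & U1 & U2)
    (v1 & v2 & v3 & Dv & Ev & V0 & V1 & V2) Hx.
  set (S := segment (-1) 0) in *.
  set (d := fun s => u s - v s). set (d1 := fun s => u1 s - v1 s).
  set (d2 := fun s => u2 s - v2 s). set (d3 := fun s => u3 s - v3 s).
  assert (D0 : forall s, S s -> D_in d d1 S s)
    by (intros s Hs; apply Dminus; [apply Du | apply Dv]; exact Hs).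
  assert (D1 : forall s, S s -> D_in d1 d2 S s)
    by (intros s Hs; apply Dminus; [apply Du | apply Dv]; exact Hs).
  assert (D2 : forall s, S s -> D_in d2 d3 S s)
    by (intros s Hs; apply Dminus; [apply Du | apply Dv]; exact Hs).
  assert (S0 : S 0) by (unfold S, segment; lra).
  (* A function whose derivative vanishes inside the segment is Lipschitz with constant 0. *)
  assert (Hconst : forall h h' : R -> R, (forall s, S s -> D_in h h' S s) ->
    (forall s, -1 < s < 0 -> h' s = 0) -> h 0 = 0 -> forall s, S s -> h s = 0).
  { intros h h' Hh Hh' H0 s Hs.
    assert (H := segment_lipschitz (-1) 0 h h' 0 0 s Hh).
    rewrite H0, Rminus_0_r, Rmult_0_l in H.
    apply Rabs_eq_0. apply Rle_antisym; [|apply Rabs_pos].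
    apply H; auto. intros y Hy. rewrite Hh', Rabs_R0 by exact Hy. lra. }
  assert (E2 : forall s, S s -> d2 s = 0).
  { intros s Hs.
    (* The derivative of the energy is 2 d2 (d3 + a d1), which is zero by the equation. *)
    assert (E : d2 s * d2 s + a * (d1 s * d1 s) = 0).
    { apply (Hconst (fun s => d2 s * d2 s + a * (d1 s * d1 s))
        (fun s => (d3 s * d2 s + d2 s * d3 s) + a * (d2 s * d1 s + d1 s * d2 s)));
        [| |unfold d2, d1; rewrite U2, V2, U1, V1; ring | exact Hs].
      - intros y Hy.
        apply (Dadd _ (fun s => d3 s * d2 s + d2 s * d3 s)
          (fun s => a * (d2 s * d1 s + d1 s * d2 s)) (fun s => d2 s * d2 s)
          (fun s => a * (d1 s * d1 s))).
        + apply Dmult; apply D2, Hy.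
        + apply (Dmult_const _ (fun s => d1 s * d1 s)
            (fun s => d2 s * d1 s + d1 s * d2 s)), Dmult; apply D1, Hy.
      - intros y Hy. specialize (Eu y Hy). specialize (Ev y Hy).
        replace (d3 y) with (- a * d1 y) by (unfold d3, d1; lra). ring. }
    assert (0 <= d2 s * d2 s) by apply Rle_0_sqr.
    assert (0 <= a * (d1 s * d1 s)) by (apply Rmult_le_pos; [lra | apply Rle_0_sqr]).
    apply Rsqr_0_uniq. unfold Rsqr. lra. }
  (* As [a] may be 0, only [d2] is read off the energy; [d1] and [d] follow by integration from zero
     data at 0. *)
  assert (E1 : forall s, S s -> d1 s = 0).
  { apply (Hconst d1 d2 D1); [|unfold d1; rewrite U1, V1; ring].
    intros s Hs. apply E2. unfold S, segment. lra. }
  assert (E0 : forall s, S s -> d s = 0).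
  { apply (Hconst d d1 D0); [|unfold d; rewrite U0, V0; ring].
    intros s Hs. apply E1. unfold S, segment. lra. }
  specialize (E0 x Hx). unfold d in E0. lra.
Qed.

Lemma cauchy_solution_gen (a : R) (f : R -> R) (i : nat) :
  0 <= a ->
  (forall x, -1 < x < 0 -> gen a i 3 x + a * gen a i 1 x = f x) ->
  cauchy_solution a f (coef a 2 i) (gen a i 0).
Proof.
  intros Ha Hf. exists (gen a i 1), (gen a i 2), (gen a i 3).
  repeat split; try (apply gen_derive, Ha); try (apply gen_at_0); exact Hf.
Qed.

(** Induction on [i] through uniqueness: the power series solves the same Cauchy problem, the
    previous case identifying the right-hand sides. *)
Lemma generating_functions_gen (a : R) (g : nat -> R -> R) (i : nat) (x : R) :
  0 <= a -> generating_functions a g -> segment (-1) 0 x -> g i x = gen a i 0 x.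
Proof.
  intros Ha [H0 HS]. revert x. induction i as [|i IH]; intros x Hx.
  - apply (cauchy_solution_unique a (fun _ => 0) 1); auto.
    apply (cauchy_solution_gen a (fun _ => 0) 0 Ha).
    intros s _. rewrite gen_ode_0 by exact Ha. ring.
  - apply (cauchy_solution_unique a (fun x => - g i x) 0); auto.
    replace 0 with (coef a 2 (S i)) at 1 by reflexivity.
    apply (cauchy_solution_gen a _ (S i) Ha).
    intros s Hs. rewrite gen_ode_S, IH by (try exact Ha; unfold segment; lra). ring.
Qed.

(** The finite sum over i is exchanged with the Taylor series over j. For each j,
    [sum_weighted_coef_le] applies at order n + j with [p] = 3k; the sum over j is then a negative
    binomial series with parameter n + 3k. *)
Lemma sum_gen_bound_le (a r : R) (n k I : nat) :
  0 <= a -> 0 < r < 1 ->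
  sum_f_R0 (fun i => gen_bound a i n * (INR (fact (3 * (i + k))) * r ^ (3 * (i + k)))) I
  <= exp (a / r ^ 2) / r ^ 2 * r ^ (n + 3 * k) *
     (INR (fact (n + 3 * k)) / (1 - r) ^ (n + 3 * k + 1)).
Proof.
  intros Ha Hr. set (C0 := exp (a / r ^ 2) / r ^ 2). set (p := (n + 3 * k)%nat).
  assert (Hr2 : 0 < r ^ 2) by (apply pow_lt; lra).
  assert (HC0 : 0 < C0) by (apply Rdiv_lt_0_compat; [apply exp_pos | lra]).
  set (w := fun i => INR (fact (3 * (i + k))) * r ^ (3 * (i + k))).
  assert (Hex : forall i, ex_series (fun j => Rabs (gen_coef a i n j) * w i))
    by (intros i; apply ex_series_scal_r, ex_series_gen_bound, Ha).
  rewrite (sum_eq _ (fun i => Series (fun j => Rabs (gen_coef a i n j) * w i)))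
    by (intros i _; rewrite Series_scal_r; reflexivity).
  pose proof (is_series_sum (fun i j => Rabs (gen_coef a i n j) * w i) I Hex) as Hs.
  apply (is_lim_seq_le
    (sum_n (fun j => sum_f_R0 (fun i => Rabs (gen_coef a i n j) * w i) I))
    (fun _ => C0 * r ^ p * (INR (fact p) / (1 - r) ^ (p + 1)))
    (Finite _) (Finite _)); [|exact Hs|apply is_lim_seq_const].
  intros J. rewrite sum_n_Reals.
  assert (HrP : 0 < r ^ p) by (apply pow_lt; lra).
  apply Rle_trans with (C0 * r ^ p *
    sum_f_R0 (fun j => INR (fact (j + p)) / INR (fact j) * r ^ j) J).
  2: { apply Rmult_le_compat_l; [apply Rmult_le_pos; lra|].
       apply binomial_series_bound; lra. }
  rewrite scal_sum. apply sum_growing. intros j.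
  pose proof (INR_fact_lt_0 j) as Hf.
  assert (Hfi : 0 < / INR (fact j)) by apply Rinv_0_lt_compat, Hf.
  rewrite (sum_eq _ (fun i => weighted_coef a r (3 * k) (n + j) i *
    (r ^ (3 * k) * / INR (fact j)))).
  2: { intros i _. unfold w, weighted_coef, gen_coef.
       rewrite Rabs_div, (Rabs_pos_eq (INR _)) by lra.
       replace (3 * (i + k))%nat with (3 * i + 3 * k)%nat by lia.
       rewrite pow_add. field. lra. }
  rewrite <- scal_sum, Rmult_comm.
  pose proof (sum_weighted_coef_le a r (3 * k) I (n + j) Ha Hr) as HW. fold C0 in HW.
  (* The exponential factor has served the induction on the order and is now bounded by 1. *)
  assert (HW' : sum_f_R0 (weighted_coef a r (3 * k) (n + j)) I <=
    C0 * (INR (fact (n + j + 3 * k)) * r ^ (n + j))).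
  { eapply Rle_trans; [exact HW|].
    apply Rmult_le_compat_r.
    - apply Rmult_le_pos; [apply pos_INR | apply pow_le; lra].
    - rewrite <- (Rmult_1_r C0) at 2. apply Rmult_le_compat_l; [lra|].
      apply Rle_trans with (exp 0); [apply exp_le_compat | rewrite exp_0; lra].
      assert (0 <= a / r ^ 2 / (INR (n + j) + 1)); [|lra].
      pose proof (pos_INR (n + j)).
      repeat apply Rdiv_le_0_compat; lra. }
  eapply Rle_trans.
  { apply Rmult_le_compat_r; [|exact HW'].
    apply Rmult_le_pos; [apply pow_le; lra | lra]. }
  right. unfold p. replace (j + (n + 3 * k))%nat with (n + j + 3 * k)%nat by lia.
  rewrite !pow_add. unfold Rdiv. ring.
Qed.

Lemma Lipschitz_continuous_on (D : R * R -> Prop) (F : R -> R -> R) (L1 L2 : R) :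
  (forall x t x' t', D (x, t) -> D (x', t') ->
     Rabs (F x' t' - F x t) <= L1 * Rabs (x' - x) + L2 * Rabs (t' - t)) ->
  continuous_on D (fun p => F (fst p) (snd p)).
Proof.
  intros HL [x t] Hxt P [eps HP].
  pose proof (Rabs_pos L1). pose proof (Rabs_pos L2).
  pose proof (Rle_abs L1). pose proof (Rle_abs L2). pose proof (cond_pos eps) as He.
  assert (Hd : 0 < eps / (Rabs L1 + Rabs L2 + 1)) by (apply Rdiv_lt_0_compat; lra).
  exists (mkposreal _ Hd). intros [x' t'] [Hx Ht] HD.
  apply HP. change (Rabs (F x' t' - F x t) < eps).
  change (Rabs (x' - x) < eps / (Rabs L1 + Rabs L2 + 1)) in Hx.
  change (Rabs (t' - t) < eps / (Rabs L1 + Rabs L2 + 1)) in Ht.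
  set (del := eps / (Rabs L1 + Rabs L2 + 1)) in *.
  replace (pos eps) with ((Rabs L1 + Rabs L2 + 1) * del) by (unfold del; field; lra).
  eapply Rle_lt_trans; [apply HL; [exact Hxt | exact HD]|].
  pose proof (Rabs_pos (x' - x)). pose proof (Rabs_pos (t' - t)). nra.
Qed.

(** * The flatness series *)

Definition flat_term (a : R) (dz : nat -> R -> R) (n k i : nat) (x t : R) : R :=
  gen a i n x * dz (i + k)%nat t.

(* The partial derivative of y of order n in x and k in t. *)
Definition flat_deriv (a : R) (dz : nat -> R -> R) (n k : nat) (x t : R) : R :=
  Series (fun i => flat_term a dz n k i x t).

Definition flat_bound (a r M : R) (n k i : nat) : R :=
  gen_bound a i n * (M * (INR (fact (3 * (i + k))) * r ^ (3 * (i + k)))).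

Lemma gen_bound_ge0 (a : R) (i n : nat) : 0 <= a -> 0 <= gen_bound a i n.
Proof.
  intros Ha. eapply Rle_trans; [apply Rabs_pos|].
  apply (gen_le_bound a i n 0 Ha). rewrite Rabs_R0. lra.
Qed.

Lemma flat_bound_series (a r M : R) (n k : nat) :
  0 <= a -> 0 < r < 1 -> 0 < M ->
  ex_series (flat_bound a r M n k) /\
  Series (flat_bound a r M n k) <=
    M * (exp (a / r ^ 2) / r ^ 2 * r ^ (n + 3 * k) *
     (INR (fact (n + 3 * k)) / (1 - r) ^ (n + 3 * k + 1))).
Proof.
  intros Ha Hr HM. apply ex_series_bounded.
  - intros i. unfold flat_bound.
    apply Rmult_le_pos; [apply gen_bound_ge0, Ha|].
    apply Rmult_le_pos; [lra|].
    apply Rmult_le_pos; [apply pos_INR | apply pow_le; lra].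
  - intros I. eapply Rle_trans.
    2: { apply Rmult_le_compat_l; [lra|]. apply (sum_gen_bound_le a r n k I Ha Hr). }
    right. rewrite scal_sum. apply sum_eq. intros i _. unfold flat_bound. ring.
Qed.

(** After (n+3k)! is split, each unit of n + 3k costs a factor 2r / (1-r). Hence the radius (1-r) /
    (2r) in x, and in t its cube divided by the 27 coming from (3k)!. *)
Lemma flat_bound_gevrey (a r M : R) (n k : nat) :
  0 <= a -> 0 < r < 1 -> 0 < M ->
  Series (flat_bound a r M n k) <=
    M * (exp (a / r ^ 2) / r ^ 2) / (1 - r) *
    (Rpower (INR (fact n)) 1 * Rpower (INR (fact k)) 3) /
    (((1 - r) / (2 * r)) ^ n * (((1 - r) / (2 * r)) ^ 3 / 27) ^ k).
Proof.
  intros Ha Hr HM.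
  eapply Rle_trans; [apply flat_bound_series; assumption|].
  assert (H3 : INR 3 = 3) by (simpl; ring).
  replace (Rpower (INR (fact k)) 3) with (INR (fact k) ^ 3)
    by (rewrite <- H3; symmetry; apply Rpower_pow, INR_fact_lt_0).
  rewrite Rpower_1 by apply INR_fact_lt_0. clear H3.
  set (C0 := exp _ / _). set (p := (n + 3 * k)%nat).
  assert (Hr2 : 0 < r ^ 2) by (apply pow_lt; lra).
  assert (HC0 : 0 < C0) by (apply Rdiv_lt_0_compat; [apply exp_pos | lra]).
  assert (Hp : 0 < r ^ p / (1 - r) ^ (p + 1))
    by (apply Rdiv_lt_0_compat; apply pow_lt; lra).
  apply Rle_trans with (M * C0 * (r ^ p / (1 - r) ^ (p + 1)) *
    (2 ^ p * (INR (fact n) * (27 ^ k * INR (fact k) ^ 3)))).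
  - replace (M * (C0 * r ^ p * (INR (fact p) / (1 - r) ^ (p + 1)))) with
      (M * C0 * (r ^ p / (1 - r) ^ (p + 1)) * INR (fact p))
      by (unfold Rdiv; ring).
    apply Rmult_le_compat_l; [apply Rmult_le_pos; [apply Rmult_le_pos|]; lra|].
    eapply Rle_trans; [apply fact_add_le|]. fold p.
    apply Rmult_le_compat_l; [apply pow_le; lra|].
    apply Rmult_le_compat_l; [apply pos_INR | apply fact_triple_le].
  - right. set (q := (1 - r) / (2 * r)).
    assert (Hq : 0 < q) by (apply Rdiv_lt_0_compat; lra).
    assert (Eq : r ^ p / (1 - r) ^ (p + 1) * 2 ^ p = / (1 - r) * / q ^ p).
    { unfold q, Rdiv. rewrite pow_add, !Rpow_mult_distr, !pow_inv, Rpow_mult_distr.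
      field. repeat split; try apply pow_nonzero; lra. }
    unfold Rdiv at 4. rewrite (Rpow_mult_distr (q ^ 3)), pow_inv, <- pow_mult.
    transitivity (M * C0 * (r ^ p / (1 - r) ^ (p + 1) * 2 ^ p) *
      (INR (fact n) * (27 ^ k * INR (fact k) ^ 3))); [ring|].
    rewrite Eq. unfold p. rewrite pow_add.
    field. repeat split; try apply pow_nonzero; lra.
Qed.

Section FlatOutput.

Variables (a r M T : R) (dz : nat -> R -> R).
Hypotheses (a_ge0 : 0 <= a) (r_bounds : 0 < r < 1) (M_gt0 : 0 < M).
Hypothesis dz_D_in : forall n t, segment 0 T t -> D_in (dz n) (dz (S n)) (segment 0 T) t.
Hypothesis dz_le : forall j t, segment 0 T t ->
  Rabs (dz j t) <= M * (INR (fact (3 * j)) * r ^ (3 * j)).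

Lemma flat_term_le (n k i : nat) (x t : R) :
  segment (-1) 0 x -> segment 0 T t ->
  Rabs (flat_term a dz n k i x t) <= flat_bound a r M n k i.
Proof.
  intros Hx Ht. unfold flat_term. rewrite Rabs_mult.
  apply Rmult_le_compat; try apply Rabs_pos; [|apply dz_le, Ht].
  apply gen_le_bound; [exact a_ge0|]. unfold segment in Hx.
  apply Rabs_le. lra.
Qed.

Lemma ex_series_flat (n k : nat) (x t : R) :
  segment (-1) 0 x -> segment 0 T t -> ex_series (fun i => flat_term a dz n k i x t).
Proof.
  intros Hx Ht. apply ex_series_abs_le with (flat_bound a r M n k).
  - intros i. apply flat_term_le; assumption.
  - apply flat_bound_series; assumption.
Qed.

Lemma flat_deriv_le (n k : nat) (x t : R) :
  segment (-1) 0 x -> segment 0 T t ->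
  Rabs (flat_deriv a dz n k x t) <= Series (flat_bound a r M n k).
Proof.
  intros Hx Ht. apply Series_abs_le.
  - intros i. apply flat_term_le; assumption.
  - apply flat_bound_series; assumption.
Qed.

Lemma flat_term_D_in_x (n k i : nat) (x t : R) :
  D_in (fun s => flat_term a dz n k i s t) (fun s => flat_term a dz (S n) k i s t)
    (segment (-1) 0) x.
Proof.
  unfold flat_term.
  apply D_in_ext with
    (f := fun s => gen a i (S n) s * dz (i + k)%nat t + gen a i n s * 0); [ring|].
  apply (Dmult _ _ (fun _ => 0) _ (fun _ => dz (i + k)%nat t)).
  - apply gen_derive, a_ge0.
  - apply Dconst.
Qed.

Lemma flat_term_D_in_t (n k i : nat) (x t : R) :
  segment 0 T t ->
  D_in (flat_term a dz n k i x) (flat_term a dz n (S k) i x) (segment 0 T) t.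
Proof.
  intros Ht. apply (Dmult_const _ (dz (i + k)%nat) (dz (i + S k)%nat)).
  rewrite Nat.add_succ_r. apply dz_D_in, Ht.
Qed.

(** Majorants are supplied up to order n + 2 because [D_in_Series] rests on a second-order Taylor
    bound. *)
Lemma flat_deriv_D_in_x (n k : nat) (x t : R) :
  segment (-1) 0 x -> segment 0 T t ->
  D_in (fun s => flat_deriv a dz n k s t) (fun s => flat_deriv a dz (S n) k s t)
    (segment (-1) 0) x.
Proof.
  intros Hx Ht.
  apply (D_in_Series (-1) 0 (fun i s => flat_term a dz n k i s t)
    (fun i s => flat_term a dz (S n) k i s t)
    (fun i s => flat_term a dz (S (S n)) k i s t)
    (flat_bound a r M n k) (flat_bound a r M (S n) k) (flat_bound a r M (S (S n)) k));
    try (apply flat_bound_series; assumption); try exact Hx;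
    intros i s Hs; try (apply flat_term_D_in_x); apply flat_term_le; assumption.
Qed.

Lemma flat_deriv_D_in_t (n k : nat) (x t : R) :
  segment (-1) 0 x -> segment 0 T t ->
  D_in (flat_deriv a dz n k x) (flat_deriv a dz n (S k) x) (segment 0 T) t.
Proof.
  intros Hx Ht.
  apply (D_in_Series 0 T (fun i s => flat_term a dz n k i x s)
    (fun i s => flat_term a dz n (S k) i x s)
    (fun i s => flat_term a dz n (S (S k)) i x s)
    (flat_bound a r M n k) (flat_bound a r M n (S k)) (flat_bound a r M n (S (S k))));
    try (apply flat_bound_series; assumption); try exact Ht;
    intros i s Hs; try (apply flat_term_D_in_t, Hs); apply flat_term_le; assumption.
Qed.

(** The next partial derivatives are bounded uniformly on the rectangle, which gives a Lipschitz
    bound in each variable; the path from (x,t) to (x',t') passes through (x,t'). *)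
Lemma flat_deriv_continuous_on (n k : nat) :
  continuous_on (rectangle (-1) 0 0 T)
    (fun p => flat_deriv a dz n k (fst p) (snd p)).
Proof.
  apply Lipschitz_continuous_on with (Series (flat_bound a r M (S n) k))
    (Series (flat_bound a r M n (S k))).
  intros x t x' t' [Hx Ht] [Hx' Ht']. simpl in *.
  replace (flat_deriv a dz n k x' t' - flat_deriv a dz n k x t) with
    ((flat_deriv a dz n k x' t' - flat_deriv a dz n k x t') +
     (flat_deriv a dz n k x t' - flat_deriv a dz n k x t)) by ring.
  eapply Rle_trans; [apply Rabs_triang|]. apply Rplus_le_compat.
  - apply (segment_lipschitz (-1) 0 (fun s => flat_deriv a dz n k s t')
      (fun s => flat_deriv a dz (S n) k s t')); try assumption.
    + intros s Hs. apply flat_deriv_D_in_x; assumption.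
    + intros s Hs. apply flat_deriv_le; [unfold segment; lra | assumption].
  - apply (segment_lipschitz 0 T (flat_deriv a dz n k x) (flat_deriv a dz n (S k) x));
      try assumption.
    + intros s Hs. apply flat_deriv_D_in_t; assumption.
    + intros s Hs. apply flat_deriv_le; [assumption | unfold segment; lra].
Qed.

Lemma flat_deriv_kdv (x t : R) :
  segment (-1) 0 x -> segment 0 T t ->
  flat_deriv a dz 0 1 x t + flat_deriv a dz 3 0 x t + a * flat_deriv a dz 1 0 x t = 0.
Proof.
  intros Hx Ht. unfold flat_deriv.
  rewrite <- Series_scal_l, Rplus_assoc, <- Series_plus.
  2: apply ex_series_flat; assumption.
  2: apply (ex_series_scal (K := R_AbsRing) a
       (fun i => flat_term a dz 1 0 i x t)), ex_series_flat; assumption.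
  (* The term i = 0 of y_xxx + a y_x vanishes by the equation of g_0. The term i + 1 is - g_i
     z^(i+1), the opposite of the i-th term of y_t. *)
  rewrite (Series_incr_1 (fun i => _ + _)).
  2: { apply (ex_series_plus (fun i => flat_term a dz 3 0 i x t)).
       - apply ex_series_flat; assumption.
       - apply (ex_series_scal (K := R_AbsRing) a
           (fun i => flat_term a dz 1 0 i x t)), ex_series_flat; assumption. }
  rewrite (Series_ext (fun i => _ + _) (fun i => -1 * flat_term a dz 0 1 i x t)).
  - rewrite Series_scal_l. unfold flat_term.
    rewrite gen_ode_0 by exact a_ge0. ring.
  - intros i. unfold flat_term. rewrite gen_ode_S by exact a_ge0.
    replace (S i + 0)%nat with (i + 1)%nat by lia. ring.
Qed.


(** At x = 0 the derivatives of the g_i are the values of [coef], and among orders up to 2 only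
    g_0''(0) = 1 is nonzero. *)
Lemma flat_deriv_left_end (n : nat) (t : R) :
  (n <= 2)%nat -> flat_deriv a dz n 0 0 t = if (n =? 2)%nat then dz 0%nat t else 0.
Proof.
  intros Hn. unfold flat_deriv, flat_term.
  rewrite (Series_ext _ (fun i => match i with
    | 0%nat => if (n =? 2)%nat then dz 0%nat t else 0 | S _ => 0 end)).
  - set (v := if (n =? 2)%nat then dz 0%nat t else 0).
    apply is_series_unique, (is_lim_seq_ext (fun _ => v) _ (Finite v));
      [|apply is_lim_seq_const].
    intros N. rewrite sum_n_Reals. induction N as [|N IH]; [reflexivity|].
    rewrite tech5, <- IH. ring.
  - intros i. rewrite gen_at_0, Nat.add_0_r.
    destruct n as [|[|[|n]]]; [| | |lia]; destruct i; simpl; ring.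
Qed.

End FlatOutput.

Theorem proposition3p1 (a T M rho : R)
  (g : nat -> R -> R) (z : R -> R) (dz : nat -> R -> R) (y : R -> R -> R)
  (a_ge0 : 0 <= a) (T_gt0 : 0 < T) (M_gt0 : 0 < M) (rho_gt1 : 1 < rho)
  (g_gen : generating_functions a g)
  (z_gevrey : gevrey 3 0 T z)
  (dz_der : derivatives 0 T z dz)
  (dz_bound : forall j t, segment 0 T t ->
     Rabs (dz j t) <= M * INR (fact (3 * j)) / rho ^ (3 * j))
  (y_def : forall x t, rectangle (-1) 0 0 T (x, t) ->
     y x t = Series (fun i => g i x * dz i t)) :
  (forall x t, rectangle (-1) 0 0 T (x, t) ->
     ex_series (fun i => g i x * dz i t)) /\
  gevrey2 1 3 (-1) 0 0 T y /\
  solves_kdv a T z y.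
Proof.
  (* The condition rho > 1 becomes r < 1, the range in which the negative binomial series
     converges. *)
  set (r := / rho).
  assert (r_bounds : 0 < r < 1).
  { unfold r. split; [apply Rinv_0_lt_compat; lra|].
    rewrite <- Rinv_1. apply Rinv_lt_contravar; lra. }
  assert (dz_le : forall j t, segment 0 T t ->
    Rabs (dz j t) <= M * (INR (fact (3 * j)) * r ^ (3 * j))).
  { intros j t Ht. unfold r. rewrite pow_inv, <- Rmult_assoc. apply dz_bound, Ht. }
  assert (dz_D_in : forall n t, segment 0 T t ->
    D_in (dz n) (dz (S n)) (segment 0 T) t) by (intros n t Ht; apply dz_der, Ht).
  (* By uniqueness the given g_i agree on the segment with the power series, so y is the flatness
     series of order (0,0). *)
  assert (Hterm : forall x t i, segment (-1) 0 x ->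
    g i x * dz i t = flat_term a dz 0 0 i x t).
  { intros x t i Hx. unfold flat_term.
    rewrite Nat.add_0_r, (generating_functions_gen a g) by assumption. reflexivity. }
  assert (Hy : forall x t, rectangle (-1) 0 0 T (x, t) ->
    y x t = flat_deriv a dz 0 0 x t).
  { intros x t Hxt. rewrite y_def by exact Hxt. apply Series_ext. intros i.
    apply Hterm, Hxt. }
  assert (Hder : partial_derivatives (-1) 0 0 T y (flat_deriv a dz)).
  { split.
    - intros x t Hxt. split; [symmetry; apply Hy, Hxt|].
      destruct Hxt as [Hx Ht]. simpl in Hx, Ht. intros n k. split.
      + apply flat_deriv_D_in_x with r M T; assumption.
      + apply flat_deriv_D_in_t with r M; assumption.
    - intros n k. apply flat_deriv_continuous_on with r M; assumption. }
  split; [|split].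
  - intros x t [Hx Ht]. simpl in Hx, Ht.
    apply (ex_series_ext (fun i => flat_term a dz 0 0 i x t)).
    + intros i. symmetry. apply Hterm, Hx.
    + apply ex_series_flat with r M T; assumption.
  - exists (flat_deriv a dz). split; [exact Hder|].
    (* These are the constants of [flat_bound_gevrey], independent of both orders of
       differentiation. *)
    exists (M * (exp (a / r ^ 2) / r ^ 2) / (1 - r)), ((1 - r) / (2 * r)),
      (((1 - r) / (2 * r)) ^ 3 / 27).
    assert (Hr2 : 0 < r ^ 2) by (apply pow_lt; lra).
    assert (Hq : 0 < (1 - r) / (2 * r)) by (apply Rdiv_lt_0_compat; lra).
    repeat split.
    + apply Rdiv_lt_0_compat; [|lra]. apply Rmult_lt_0_compat; [lra|].
      apply Rdiv_lt_0_compat; [apply exp_pos | lra].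
    + exact Hq.
    + apply Rdiv_lt_0_compat; [apply pow_lt, Hq | lra].
    + intros n k x t [Hx Ht]. simpl in Hx, Ht.
      eapply Rle_trans; [apply flat_deriv_le with (r := r) (M := M) (T := T); assumption|].
      apply flat_bound_gevrey; assumption.
  - exists (flat_deriv a dz). split; [exact Hder|]. split.
    + intros x t Hx Ht. apply flat_deriv_kdv with r M T; unfold segment; auto; lra.
    + intros t Ht. assert (HtT : segment 0 T t) by (unfold segment; lra).
      rewrite Hy by (split; simpl; [unfold segment; lra | exact HtT]).
      rewrite !flat_deriv_left_end by lia. simpl.
      repeat split. apply dz_der, HtT.
Qed.
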